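(* We have $\mathbb{S}(1,1;\alpha,\beta,\lambda,\mu)=1$, and for all integers $n\ge 2$ and $1\le m\le n$, $$\mathbb{S}(n,m;\alpha,\beta,\lambda,\mu)=(\alpha+(m-1)\beta)\,\mathbb{S}(n-1,m-1;\alpha,\beta,\lambda,\mu)+(m\lambda+(n-1)\mu)\,\mathbb{S}(n-1,m;\alpha,\beta,\lambda,\mu).$$
   Context: $\mathrm{LLP}_{n,m}$ is the set of all ''list of lists'' partitions of $[n]=\{1,\dots,n\}$ into $m$ blocks: ordered sequences $\pi=B_1/B_2/\cdots/B_m$ of nonempty disjoint blocks with union $[n]$, where in addition the elements inside each block are linearly ordered (each block is a word $B_\ell=\sigma_1\cdots\sigma_{n_\ell}$). For $\pi\in\mathrm{LLP}_{n,m}$ define four statistics. (1) $\mathrm{rlb}(\pi)$ is the number of indices $j$ such that $\min B_j<\min B_l$ for all $l>j$ and $\min B_j>1$. (2) $\mathrm{nsb}(\pi)$ is the number of blocks that must be moved to the right to make the sequence of block minima increasing, i.e. the number of indices $j$ for which there is $l>j$ with $\min B_l<\min B_j$; thus $\mathrm{nsb}(\pi)+\mathrm{rlb}(\pi)=m-1$. (3) For a block $B_\ell=\sigma_1\cdots\sigma_{n_\ell}$, $\mathrm{rle}(B_\ell)$ is the number of indices $j$ such that $\sigma_j<\sigma_l$ for all $l>j$ and $\sigma_j>\min B_\ell$; and $\mathrm{rle}(\pi)=\sum_{\ell}\mathrm{rle}(B_\ell)$. (4) $\mathrm{nse}(\pi)$ is the total number of elements that must be moved to the right inside their blocks to make every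 block increasing, i.e. the number of elements that are followed, somewhere later in the same block, by a smaller element; thus $\mathrm{nse}(\pi)+\mathrm{rle}(\pi)=n-m$. For integers $1\le m\le n$ define $$\mathbb{S}(n,m;\alpha,\beta,\lambda,\mu)=\sum_{\pi\in\mathrm{LLP}_{n,m}}\alpha^{\mathrm{rlb}(\pi)}\beta^{\mathrm{nsb}(\pi)}\lambda^{\mathrm{rle}(\pi)}\mu^{\mathrm{nse}(\pi)},$$ a polynomial in the indeterminates $\alpha,\beta,\lambda,\mu$; set $\mathbb{S}(n,m;\alpha,\beta,\lambda,\mu)=0$ for all other $(n,m)$. *)

(* Defs.v *)
From mathcomp Require Import all_boot all_order all_algebra.
From mathcomp Require Export mpoly.

Set Implicit Arguments.
Unset Strict Implicit.
Unset Printing Implicit Defensive.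

(* A block is a word of naturals, a list of lists is a seq of such words, with
   the elements 1, ..., n of [n] represented by the naturals 1, ..., n. *)
Definition is_LLP (n m : nat) (p : seq (seq nat)) : bool :=
  [&& size p == m, all (fun B => B != [::]) p
    & perm_eq (flatten p) (iota 1 n)].

(* minn has no neutral element: the fold starts from the first letter, so this
   is the minimum when B is nonempty (blocks always are). *)
Definition bmin (B : seq nat) : nat := foldr minn (head 0 B) B.

(* Number of right-to-left minima of s that are larger than c. *)
Definition rlmin (c : nat) (s : seq nat) : nat :=
  #|[set j : 'I_(size s) |
      [forall l : 'I_(size s), (j < l) ==> (nth 0 s j < nth 0 s l)]
      && (c < nth 0 s j)]|.

Definition nrlmin (s : seq nat) : nat :=
  #|[set j : 'I_(size s) |
      [exists l : 'I_(size s), (j < l) && (nth 0 s l < nth 0 s j)]]|.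

Definition rlb (p : seq (seq nat)) : nat := rlmin 1 (map bmin p).

Definition nsb (p : seq (seq nat)) : nat := nrlmin (map bmin p).

Definition rle (p : seq (seq nat)) : nat := \sum_(B <- p) rlmin (bmin B) B.

Definition nse (p : seq (seq nat)) : nat := \sum_(B <- p) nrlmin B.

(* Finite type containing (a copy of) every list of lists with m blocks on
   {1, ..., n}: each block is a word of length at most n over {0, ..., n}; the
   letter 0 is excluded by is_LLP. *)
Definition words (n m : nat) (p : m.-tuple (n.-bseq 'I_n.+1)) : seq (seq nat) :=
  [seq [seq val x | x <- val B] | B <- val p].

Definition LLP (n m : nat) : {set m.-tuple (n.-bseq 'I_n.+1)} :=
  [set p | is_LLP n m (words p)].

Lemma words_inj n m : injective (@words n m).
Proof.
move=> p q; rewrite /words => pq; apply: val_inj; move: pq.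
by apply: inj_map => A B /(inj_map val_inj) AB; apply: val_inj.
Qed.

(* With words_inj: words is a bijection from LLP n m onto the lists of lists,
   so the bounds built into the finite type lose nothing. *)
Lemma LLP_complete n m (s : seq (seq nat)) :
  is_LLP n m s -> exists2 p, p \in LLP n m & words p = s.
Proof.
move=> s_LLP; have /and3P[/eqP sz_s _ s_perm] := s_LLP.
have letters B : B \in s -> {subset B <= iota 1 n}.
  move=> Bs x xB; rewrite -(perm_mem s_perm).
  by apply/flattenP; exists B.
have len B : B \in s -> size B <= n.
  move=> Bs; rewrite -(size_iota 1 n) -(perm_size s_perm) size_flatten /shape.
  by rewrite sumnE big_map (big_rem B Bs) /= leq_addr.
pose w B : n.-bseq 'I_n.+1 := insub_bseq n (map inord B).
have w_size : size (map w s) == m by rewrite size_map sz_s.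
have wE : words (Tuple w_size) = s.
  rewrite /words /= -map_comp -[RHS]map_id; apply/eq_in_map => B Bs /=.
  rewrite /w /insub_bseq val_insubd size_map len //.
  rewrite -map_comp -[RHS]map_id; apply/eq_in_map => x xB /=.
  have := letters B Bs x xB; rewrite mem_iota add1n => /andP[_ lex].
  by rewrite inordK.
by exists (Tuple w_size) => //; rewrite inE wE.
Qed.

Import GRing.Theory.
Local Open Scope ring_scope.

Definition alpha : {mpoly int[4]} := 'X_(@Ordinal 4 0 isT).
Definition beta : {mpoly int[4]} := 'X_(@Ordinal 4 1 isT).
Definition lambda : {mpoly int[4]} := 'X_(@Ordinal 4 2 isT).
Definition mu : {mpoly int[4]} := 'X_(@Ordinal 4 3 isT).

Definition SS (n m : nat) : {mpoly int[4]} :=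
  if (1 <= m <= n)%N then
    \sum_(p in LLP n m)
       alpha ^+ rlb (words p) * beta ^+ nsb (words p)
       * lambda ^+ rle (words p) * mu ^+ nse (words p)
  else 0.

(* Main.v *)
(* Deleting the largest letter n of a list of lists on [n] leaves a list of
   lists q on [n-1].  If n was a block of its own, it came from inserting [n]
   into q as a block: at the end this adds one to rlb, at each of the other m-1
   places it adds one to nsb.  Otherwise n was inserted into an existing block:
   at the end of one of the m blocks this adds one to rle, before one of the
   n-1 letters it adds one to nse.  The other statistics are unchanged, since n
   is never the minimum of a block with another letter.  Both insertions obey
   the same count, applied to the word of block minima and to each block: a new
   largest letter in a word is a right-to-left minimum exactly at the end. *)
Require Import Defs.
From mathcomp Require Import all_boot all_order all_algebra ring.

Set Implicit Arguments.
Unset Strict Implicit.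
Unset Printing Implicit Defensive.

(** * Recursion of the two counts on the first letter *)

Lemma rlmin_cons c y t :
  rlmin c (y :: t) = (all (ltn y) t && (c < y)) + rlmin c t.
Proof.
rewrite /rlmin -!sum1dep_card big_mkcond big_ord_recl /=.
congr (nat_of_bool _ + _).
  rewrite -big_andE big_mkcond big_ord_recl /= -big_all (big_nth 0) big_mkord.
  by congr (_ && _); apply: eq_bigr => i _.
rewrite -big_mkcond; apply: eq_bigl => j.
(* Letters of the tail look only to their right, so position 0 adds a vacuous condition. *)
by rewrite -!big_andE big_mkcond [in RHS]big_mkcond big_ord_recl.
Qed.

Lemma nrlmin_cons y t : nrlmin (y :: t) = has (gtn y) t + nrlmin t.
Proof.
rewrite /nrlmin -!sum1dep_card big_mkcond big_ord_recl /=.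
congr (nat_of_bool _ + _).
  rewrite -big_orE big_mkcond big_ord_recl /= -big_has (big_nth 0) big_mkord.
  by apply: eq_bigr => i _.
rewrite -big_mkcond; apply: eq_bigl => j.
by rewrite -!big_orE big_mkcond [in RHS]big_mkcond big_ord_recl.
Qed.

Lemma rlmin_nil c : rlmin c [::] = 0.
Proof. by apply/eqP; rewrite cards_eq0; apply/eqP/setP => -[]. Qed.

Lemma nrlmin_nil : nrlmin [::] = 0.
Proof. by apply/eqP; rewrite cards_eq0; apply/eqP/setP => -[]. Qed.

Lemma bmin_cons b B : B != [::] -> bmin (b :: B) = minn b (bmin B).
Proof.
have fold h h' s : foldr minn (minn h h') s = minn h (foldr minn h' s).
  by elim: s => //= y s ->; rewrite minnCA.
case: B => // c B _; rewrite /bmin /= -!fold.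
by rewrite minnn [minn c b]minnC minnA minnn.
Qed.

(** * Insertion and deletion *)

Fixpoint inserts (T : Type) (x : T) (s : seq T) : seq (seq T) :=
  (x :: s) :: if s is y :: t then [seq y :: u | u <- inserts x t] else [::].

Fixpoint block_inserts (x : nat) (q : seq (seq nat)) : seq (seq (seq nat)) :=
  if q is B :: r then
    [seq C :: r | C <- inserts x B] ++ [seq B :: r' | r' <- block_inserts x r]
  else [::].

Lemma insertsP (T : eqType) (x : T) s u :
  reflect (exists s1 s2, s = s1 ++ s2 /\ u = s1 ++ x :: s2)
          (u \in inserts x s).
Proof.
apply: (iffP idP) => [|[s1 [s2 [-> ->]]]].
  elim: s u => [|y t IH] u /=; rewrite inE.
    by move/eqP->; exists [::], [::].
  case/orP => [/eqP-> | /mapP[v /IH[s1 [s2 [-> ->]]] ->]].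
    by exists [::], (y :: t).
  by exists (y :: s1), s2.
elim: s1 => [|y s1 IH] /=; first by case: s2 => *; rewrite inE eqxx.
by rewrite inE map_f ?orbT.
Qed.

Lemma block_insertsP x q p :
  reflect (exists q1 B C q2, [/\ q = q1 ++ B :: q2, C \in inserts x B
                               & p = q1 ++ C :: q2])
          (p \in block_inserts x q).
Proof.
apply: (iffP idP) => [|[q1 [B [C [q2 [-> CB ->]]]]]].
  elim: q p => [|B r IH] p //=; rewrite mem_cat.
  case/orP => [/mapP[C CB ->] | /mapP[r' /IH[q1 [B1 [C [q2 [-> CB ->]]]]] ->]].
    by exists [::], B, C, r.
  by exists (B :: q1), B1, C, q2.
elim: q1 => [|D q1 IH] /=; first by rewrite mem_cat map_f.
by rewrite mem_cat orbC map_f.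
Qed.

Lemma perm_inserts (T : eqType) (x : T) s u :
  u \in inserts x s -> perm_eq u (x :: s).
Proof.
by case/insertsP => s1 [s2 [-> ->]]; rewrite -cat1s perm_catCA.
Qed.

(** The place of [x] can be read off the result, since [x] occurs nowhere else. *)
Lemma uniq_inserts (T : eqType) (x : T) s : x \notin s -> uniq (inserts x s).
Proof.
elim: s => //= y t IH; rewrite inE negb_or => /andP[xy xt].
rewrite map_inj_uniq ?IH //; last by move=> ? ? [].
by rewrite andbT; apply/mapP => -[u _ [/eqP]]; rewrite (negPf xy).
Qed.

Lemma uniq_block_inserts x q :
  x \notin flatten q -> uniq (block_inserts x q).
Proof.
elim: q => //= B r IH; rewrite mem_cat negb_or => /andP[xB xr].
rewrite cat_uniq !map_inj_uniq ?IH ?uniq_inserts //; try by move=> ? ? [].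
rewrite andbT; apply/hasPn => _ /mapP[r' _ ->].
(* A common member would have a first block that both contains [x] and equals [B]. *)
apply/mapP => -[C /perm_inserts/perm_mem CB [BC _]].
by move: xB; rewrite BC CB mem_head.
Qed.

Lemma map_inserts (T U : Type) (f : T -> U) x s :
  map (map f) (inserts x s) = inserts (f x) (map f s).
Proof.
by elim: s => //= y t IH; rewrite -IH -!map_comp.
Qed.

(** Left inverse of both kinds of insertion: dropping emptied blocks undoes the insertion of
    [[:: x]]. *)
Definition delete (x : nat) (p : seq (seq nat)) : seq (seq nat) :=
  [seq B <- [seq filter (predC1 x) B | B <- p] | B != [::]].

Lemma delete_cat x p q : delete x (p ++ q) = delete x p ++ delete x q.
Proof. by rewrite /delete map_cat filter_cat. Qed.

Lemma delete_id x q :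
  all (fun B => B != [::]) q -> x \notin flatten q -> delete x q = q.
Proof.
rewrite /delete; elim: q => //= B r IH /andP[nB nr].
rewrite mem_cat negb_or => /andP[xB xr].
have -> : [seq y <- B | y != x] = B.
  by apply/all_filterP/allP => y yB; apply: contraNneq xB => <-.
by rewrite nB IH.
Qed.

Lemma delete_inserts x q p : all (fun B => B != [::]) q ->
  x \notin flatten q -> p \in inserts [:: x] q -> delete x p = q.
Proof.
move=> nq xq /insertsP[q1 [q2 [qE ->]]]; rewrite -[RHS](delete_id nq xq) qE.
by rewrite !delete_cat; congr (_ ++ _); rewrite /delete /= eqxx.
Qed.

Lemma delete_block_inserts x q p : all (fun B => B != [::]) q ->
  x \notin flatten q -> p \in block_inserts x q -> delete x p = q.
Proof.
move=> nq xq /block_insertsP[q1 [B [C [q2 [qE CB ->]]]]].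
rewrite -[RHS](delete_id nq xq) qE !delete_cat; congr (_ ++ _).
case/insertsP: CB => s1 [s2 [-> ->]].
by rewrite /delete /= !filter_cat /= eqxx.
Qed.

(** * Decomposition of the lists of lists on [n+1] *)

Lemma perm_iotaS n : perm_eq (iota 1 n.+1) (n.+1 :: iota 1 n).
Proof. by rewrite -{1}(addn1 n) iotaD cats1 perm_rcons. Qed.

Lemma LLP_notin n m q : is_LLP n m q -> n.+1 \notin flatten q.
Proof.
by case/and3P => _ _ /perm_mem->; rewrite mem_iota add1n ltnn andbF.
Qed.

Lemma LLP_lt n m q : is_LLP n m q -> {in flatten q, forall y, y < n.+1}.
Proof.
by case/and3P => _ _ /perm_mem qE y; rewrite qE mem_iota add1n => /andP[].
Qed.

Lemma perm_flatten_block_inserts x q p : p \in block_inserts x q ->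
  perm_eq (flatten p) (x :: flatten q).
Proof.
case/block_insertsP => q1 [B [C [q2 [-> /perm_inserts CB ->]]]].
rewrite !flatten_cat /= perm_sym -cat1s perm_catCA perm_cat2l.
by rewrite catA perm_cat2r perm_sym.
Qed.

Lemma perm_flatten_inserts (x : nat) q p : p \in inserts [:: x] q ->
  perm_eq (flatten p) (x :: flatten q).
Proof. by move=> pI; apply: perm_flatten (perm_inserts pI). Qed.

Lemma LLP_inserts n m q p : is_LLP n m q ->
  p \in inserts [:: n.+1] q -> is_LLP n.+1 m.+1 p.
Proof.
case/and3P=> /eqP sq nq pq /[dup] /perm_inserts pp /perm_flatten_inserts fp.
rewrite /is_LLP (perm_size pp) (perm_all _ pp) /= sq eqxx nq /=.
by rewrite (permPl fp) (permPr (perm_iotaS n)) perm_cons.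
Qed.

Lemma LLP_block_inserts n m q p : is_LLP n m q ->
  p \in block_inserts n.+1 q -> is_LLP n.+1 m p.
Proof.
case/and3P=> /eqP sq nq pq /[dup] pI /perm_flatten_block_inserts fp.
rewrite /is_LLP (permPl fp) (permPr (perm_iotaS n)) perm_cons pq andbT.
move: pI sq nq => /block_insertsP[q1 [B [C [q2 [-> /perm_inserts CB ->]]]]].
rewrite !size_cat !all_cat /= => -> /and3P[-> _ ->]; rewrite eqxx andbT /=.
by apply/eqP => C0; move: (perm_size CB); rewrite C0.
Qed.

Lemma LLP_split n m p : is_LLP n.+1 m.+1 p ->
  (exists2 q, is_LLP n m q & p \in inserts [:: n.+1] q) \/
  (exists2 q, is_LLP n m.+1 q & p \in block_inserts n.+1 q).
Proof.
case/and3P => /eqP sp np pp.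
have: n.+1 \in flatten p.
  by rewrite (perm_mem pp) mem_iota add1n ltnSn.
case/flattenP => C /[swap] /splitPr[s1 s2].
set C' := s1 ++ _ => /splitPr pC.
case: pC sp np pp => p1 p2 sp np pp.
have C'E : s1 ++ s2 = [::] -> C' = [:: n.+1].
  by rewrite /C'; case: (s1) (s2) => [|? ?] [|].
(* [s1 ++ s2] is what remains of the block [C'] of the largest letter; it is empty exactly when that
   letter is a block of its own. *)
have [s0 | s_neq0] := eqVneq (s1 ++ s2) [::].
  left; exists (p1 ++ p2).
    apply/and3P; split.
    - by rewrite -eqSS -sp !size_cat addnS.
    - by move: np; rewrite !all_cat /= => /and3P[-> _ ->].
    rewrite -(perm_cons n.+1) -(permPr (perm_iotaS n)) -(permPr pp) C'E //.
    by rewrite !flatten_cat /= -cat1s perm_catCA.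
  apply/insertsP; exists p1, p2; split=> //.
  by rewrite C'E.
have pI : p1 ++ C' :: p2 \in block_inserts n.+1 (p1 ++ (s1 ++ s2) :: p2).
  apply/block_insertsP; exists p1, (s1 ++ s2), C', p2; split=> //.
  by apply/insertsP; exists s1, s2.
right; exists (p1 ++ (s1 ++ s2) :: p2) => //; apply/and3P; split.
- by rewrite -sp !size_cat.
- by move: np; rewrite !all_cat /= s_neq0 => /and3P[-> _ ->].
rewrite -(perm_cons n.+1) -(permPl (perm_flatten_block_inserts pI)) (permPl pp).
exact: perm_iotaS.
Qed.

(** A duplicate-free enumeration, so that the decomposition becomes a [perm_eq] under which sums can
    be rewritten. *)
Definition LLPs n m : seq (seq (seq nat)) := map (@words n m) (enum (LLP n m)).

Lemma mem_LLPs n m p : (p \in LLPs n m) = is_LLP n m p.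
Proof.
apply/mapP/idP => [[t]|/LLP_complete[t tL <-]].
  by rewrite mem_enum inE => ? ->.
by exists t; rewrite ?mem_enum.
Qed.

Lemma uniq_LLPs n m : uniq (LLPs n m).
Proof. by rewrite map_inj_uniq ?enum_uniq //; apply: words_inj. Qed.

(** Deletion recovers [q] from any member of [f q], so the families of distinct [q] are disjoint. *)
Lemma uniq_flatten_delete x (f : seq (seq nat) -> seq (seq (seq nat))) s :
    uniq s -> {in s, forall q, uniq (f q)} ->
    {in s, forall q, {in f q, forall p, delete x p = q}} ->
  uniq (flatten (map f s)).
Proof.
elim: s => //= q s IH /andP[qs us] uf df; rewrite cat_uniq uf ?mem_head //=.
rewrite IH // ?andbT; last 2 first.
- by move=> r rs; apply: uf; rewrite inE rs orbT.
- by move=> r rs; apply: df; rewrite inE rs orbT.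
apply/hasPn => p /flatten_mapP[r rs pr]; apply/negP => pq.
move: qs; rewrite -(df _ (mem_head _ _) _ pq).
by rewrite (df r) ?rs // inE rs orbT.
Qed.

Lemma perm_LLPsS n m : perm_eq (LLPs n.+1 m.+1)
  (flatten [seq inserts [:: n.+1] q | q <- LLPs n m] ++
   flatten [seq block_inserts n.+1 q | q <- LLPs n m.+1]).
Proof.
have del1 : {in LLPs n m, forall q, {in inserts [:: n.+1] q,
    forall p, delete n.+1 p = q}}.
  move=> q; rewrite mem_LLPs => qL p; apply: delete_inserts.
    by case/and3P: qL.
  exact: LLP_notin qL.
have del2 : {in LLPs n m.+1, forall q, {in block_inserts n.+1 q,
    forall p, delete n.+1 p = q}}.
  move=> q; rewrite mem_LLPs => qL p; apply: delete_block_inserts.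
    by case/and3P: qL.
  exact: LLP_notin qL.
apply: uniq_perm; first exact: uniq_LLPs.
  rewrite cat_uniq; apply/and3P; split.
  - apply: uniq_flatten_delete del1; first exact: uniq_LLPs.
    move=> q; rewrite mem_LLPs => qL; apply: uniq_inserts.
    apply: contra (LLP_notin qL) => nq; apply/flattenP.
    by exists [:: n.+1]; rewrite ?mem_head.
  (* Deletion from a common member would give one list with both [m] and [m.+1] blocks. *)
  - apply/hasPn => p /flatten_mapP[r rL pr]; apply/negP => /flatten_mapP[q qL].
    move=> /(del1 q qL); rewrite (del2 r rL) // => rq.
    move: rL qL; rewrite rq !mem_LLPs => /and3P[/eqP sq _ _] /and3P[].
    by rewrite sq eqn_leq ltnn.
  - apply: uniq_flatten_delete del2; first exact: uniq_LLPs.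
    by move=> q; rewrite mem_LLPs => /LLP_notin; apply: uniq_block_inserts.
move=> p; rewrite mem_LLPs mem_cat.
apply/idP/orP => [/LLP_split[[q qL pq]|[q qL pq]]|[]/flatten_mapP[q]].
- by left; apply/flatten_mapP; exists q; rewrite ?mem_LLPs.
- by right; apply/flatten_mapP; exists q; rewrite ?mem_LLPs.
- by rewrite mem_LLPs; apply: LLP_inserts.
- by rewrite mem_LLPs; apply: LLP_block_inserts.
Qed.

(** * Statistics that an insertion preserves *)

Lemma mem_bmin B : B != [::] -> bmin B \in B.
Proof.
elim: B => // b B IH _; have [-> | B0] := eqVneq B [::].
  by rewrite /bmin /= minnn mem_head.
rewrite bmin_cons // inE /minn; case: ifP; rewrite ?eqxx // => _.
by rewrite IH // orbT.
Qed.

Lemma bmin_inserts x B C : B != [::] -> {in B, forall y, y < x} ->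
  C \in inserts x B -> bmin C = bmin B.
Proof.
elim: B C => // b B IH C B0 ltBx; rewrite inE => /orP[/eqP-> | /mapP[u uB ->]].
  rewrite (bmin_cons x B0); apply/minn_idPr.
  by rewrite ltnW // ltBx // mem_bmin.
(* [bmin_cons] asks for a nonempty tail, so a one-letter block is computed directly. *)
have [B1 | B1] := eqVneq B [::].
  move: uB; rewrite B1 inE => /eqP->; rewrite /bmin /= minnn.
  by rewrite minnCA minnn; apply/minn_idPr; rewrite ltnW // ltBx ?mem_head.
have u0 : u != [::] by case: u uB => // /perm_inserts/perm_size.
rewrite !bmin_cons // (IH u) // => y yB.
by rewrite ltBx // inE yB orbT.
Qed.

Lemma map_bmin_block_inserts x q p : all (fun B => B != [::]) q ->
  {in flatten q, forall y, y < x} -> p \in block_inserts x q ->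
  map bmin p = map bmin q.
Proof.
move=> nq ltx /block_insertsP[q1 [B [C [q2 [qE CB ->]]]]].
move: nq ltx; rewrite qE all_cat flatten_cat /= => /and3P[_ nB _] ltx.
rewrite !map_cat /= (bmin_inserts nB _ CB) // => y yB.
by rewrite ltx // !mem_cat yB orbT.
Qed.

(** The sum ignores the order of the blocks, and the only letter of [[:: x]] is its minimum, which
    [rle] does not count. *)
Lemma rle_inserts x q p : p \in inserts [:: x] q -> rle p = rle q.
Proof.
move=> /perm_inserts pq; rewrite /rle (perm_big _ pq) big_cons.
by rewrite rlmin_cons rlmin_nil /bmin /= minnn ltnn.
Qed.

Lemma nse_inserts x q p : p \in inserts [:: x] q -> nse p = nse q.
Proof.
move=> /perm_inserts pq; rewrite /nse (perm_big _ pq) big_cons.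
by rewrite nrlmin_cons nrlmin_nil.
Qed.

(** * Weighted sums over insertions *)

Import GRing.Theory.
Local Open Scope ring_scope.

(** Of the [size s + 1] places, the last gives [a] and each other gives [b]. The threshold [c] is 1
    for the word of block minima and [bmin B] for the letters of a block. *)
Lemma sum_inserts (R : comNzRingType) (a b : R) c x s :
    (c < x)%N -> {in s, forall y, (y < x)%N} ->
  \sum_(u <- inserts x s) a ^+ rlmin c u * b ^+ nrlmin u =
  (a + (size s)%:R * b) * (a ^+ rlmin c s * b ^+ nrlmin s).
Proof.
move=> cx; elim: s => [|y t IH] ltx /=.
  by rewrite big_seq1 rlmin_cons nrlmin_cons rlmin_nil nrlmin_nil /= cx; ring.
have yx : (y < x)%N by rewrite ltx ?mem_head.
have {}IH := IH (sub_in1 (@mem_behead _ (y :: t)) ltx).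
(* [F] is the share of the head [y]; a larger letter inserted to its right does not change it, so it
   factors out of all insertions but the first. *)
pose F := a ^+ (all (ltn y) t && (c < y)%N) * b ^+ has (gtn y) t.
rewrite big_cons big_map (eq_big_seq (fun u =>
  F * (a ^+ rlmin c u * b ^+ nrlmin u))) => [|u /perm_inserts ux].
  rewrite -big_distrr IH /= (rlmin_cons c x) (nrlmin_cons x).
  rewrite !(rlmin_cons c y) !(nrlmin_cons y) /= yx.
  rewrite [(x < y)%N]ltnNge (ltnW yx) /=.
  by rewrite /F !exprD -natr1; ring.
rewrite rlmin_cons nrlmin_cons (perm_all _ ux) (perm_has _ ux) /= yx.
by rewrite [(x < y)%N]ltnNge (ltnW yx) /= /F !exprD; ring.
Qed.

(** A block of k letters contributes the factor a + k b, and these factors add up over the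
    blocks. *)
Lemma sum_block_inserts (R : comNzRingType) (a b : R) x q :
    all (fun B => B != [::]) q -> {in flatten q, forall y, (y < x)%N} ->
  \sum_(p <- block_inserts x q) a ^+ rle p * b ^+ nse p =
  ((size q)%:R * a + (size (flatten q))%:R * b) * (a ^+ rle q * b ^+ nse q).
Proof.
elim: q => [|B r IH] /=; first by rewrite big_nil !mul0r addr0 mul0r.
case/andP=> nB nr ltx.
have ltBx : {in B, forall y, (y < x)%N}.
  by move=> y yB; rewrite ltx // mem_cat yB.
have ltrx : {in flatten r, forall y, (y < x)%N}.
  by move=> y yr; rewrite ltx // mem_cat yr orbT.
have {}IH := IH nr ltrx.
rewrite /rle /nse in IH *; rewrite big_cat !big_map /=.
(* [bmin C] must become [bmin B], because [sum_inserts] takes one threshold for all insertions. *)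
under eq_big_seq => C CB.
  rewrite !big_cons !exprD (bmin_inserts nB ltBx CB) mulrACA.
  over.
rewrite -big_distrl sum_inserts /= ?ltBx ?mem_bmin //.
under [X in _ + X = _]eq_bigr => p _ do rewrite !big_cons !exprD mulrACA.
by rewrite -big_distrr IH /= !big_cons !exprD size_cat natrD -natr1; ring.
Qed.

(** * The polynomials and their recurrence *)

Definition weight (p : seq (seq nat)) : {mpoly int[4]} :=
  alpha ^+ rlb p * beta ^+ nsb p * lambda ^+ rle p * mu ^+ nse p.

(** For positive [n] the value 0 outside the range is an empty sum. At n = m = 0 the empty list
    would contribute 1. *)
Lemma SSE n m : (0 < n)%N -> SS n m = \sum_(p <- LLPs n m) weight p.
Proof.
move=> n0; rewrite /SS; case: ifP => [_ | /negbT mn].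
  by rewrite big_map -big_enum.
rewrite big_seq big1 // => p; rewrite mem_LLPs => /and3P[/eqP sp np pp].
case/negP: mn; rewrite -sp; apply/andP; split.
  by case: p sp np pp n0 => //= _ _ /perm_size; rewrite size_iota => <-.
(* Each block has at least one letter, so there are at most [n] blocks. *)
rewrite -(size_iota 1 n) -(perm_size pp) size_flatten -(size_map size p).
elim: p {sp pp} np => //= B p IH /andP[B0 /IH]; rewrite -addn1 addnC.
by apply: leq_add; case: B B0.
Qed.

(** Inserting the block [[:: n.+1]] inserts the letter [n.+1] into the word of minima; [0 < n] puts
    this letter above the threshold 1 of [rlb]. *)
Lemma sum_weight_inserts n m q : (0 < n)%N -> is_LLP n m q ->
  \sum_(p <- inserts [:: n.+1] q) weight p =
  (alpha + m%:R * beta) * weight q.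
Proof.
move=> n0 qL; have /and3P[/eqP sq nq _] := qL.
under eq_big_seq => p pq.
  rewrite /weight (rle_inserts pq) (nse_inserts pq) -mulrA.
  over.
rewrite -big_distrl /= /rlb /nsb -(big_map (map bmin) xpredT
  (fun u => alpha ^+ rlmin 1 u * beta ^+ nrlmin u)).
rewrite map_inserts /= [bmin [:: _]]/bmin /= minnn sum_inserts //.
  by rewrite size_map sq /weight -!mulrA.
move=> _ /mapP[B Bq ->]; apply: (LLP_lt qL); apply/flattenP; exists B => //.
exact/mem_bmin/(allP nq).
Qed.

Lemma sum_weight_block_inserts n m q : is_LLP n m q ->
  \sum_(p <- block_inserts n.+1 q) weight p =
  (m%:R * lambda + n%:R * mu) * weight q.
Proof.
move=> qL; have /and3P[/eqP sq nq /perm_size] := qL; rewrite size_iota => sfq.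
under eq_big_seq => p pq.
  rewrite /weight /rlb /nsb (map_bmin_block_inserts nq (LLP_lt qL) pq) -mulrA.
  over.
rewrite -big_distrr /= (sum_block_inserts _ _ nq (LLP_lt qL)) sq sfq.
by rewrite /weight /rlb /nsb; ring.
Qed.

Theorem theorem4p2 :
  SS 1 1 = 1 /\
  (forall n m : nat, (2 <= n)%N -> (1 <= m <= n)%N ->
     SS n m = (alpha + (m - 1)%:R * beta) * SS (n - 1) (m - 1)
              + (m%:R * lambda + (n - 1)%:R * mu) * SS (n - 1) m).
Proof.
split.
  rewrite SSE // (perm_big [:: [:: [:: 1%N]]]) => [|/=]; last first.
    apply: uniq_perm; rewrite ?uniq_LLPs // => p; rewrite mem_LLPs inE.
    (* The single block is a permutation of the one-letter word 1. *)
    apply/idP/eqP => [|-> //]; case/and3P; case: p => [|B [|]] //= _ _.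
    by rewrite cats0 => /perm_small_eq->.
  rewrite big_seq1 /weight /rlb /nsb /rle /nse !big_seq1 /=.
  rewrite !rlmin_cons !nrlmin_cons !rlmin_nil !nrlmin_nil /bmin /=.
  by rewrite !mulr1.
(* Since n - 1 is positive, [SSE] also covers the boundary terms with m - 1 = 0 or m = n. *)
case=> [|[|n]] // [|m] // _ _; rewrite !subn1 /= !SSE //.
rewrite (perm_big _ (perm_LLPsS n.+1 m)) big_cat !big_flatten /=.
rewrite big_map [X in _ + X]big_map !big_distrr.
congr (_ + _); apply: eq_big_seq => q; rewrite mem_LLPs.
  exact: sum_weight_inserts.
exact: sum_weight_block_inserts.
Qed.
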